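(* For arbitrary predetermined small enough tolerance $\epsilon>0$, constant $\Delta\gg\sqrt\epsilon$, and even integer $d\ge4$, let $f_{\Delta,\epsilon}:\mathbb{R}^2\to\mathbb{R}$ be the function defined in the context. Then the following properties hold for $f:=f_{\Delta,\epsilon}$: (i) $f$ is continuously differentiable and coercive with bounded level sets. (ii) The optimal solution is $x^*=(x_1^*,x_2^* )=(\Delta\epsilon^{-200},0)$. With $x^0=0$ as the default initial solution, the function value gap $\Delta_f:=f(0)-f(x^* )$ satisfies $\Delta_f=\Theta(\Delta)$. (iii) If $\|\nabla f(\bar x)\|^2\le\epsilon$, then one must have $\|\bar x\|\ge\Omega\Big(\frac{\Delta_f}{\sqrt\epsilon\,\ln^2(\Delta_f/\sqrt\epsilon)}\Big)$. For example, $(x_1^\epsilon,x_2^\epsilon)=(\Delta\epsilon^{-1/2},0)$ is such an $\epsilon$-stationary point. This property also shows that the bound $R_T\le\mathcal{O}\big(\frac{\Delta_f}{\sqrt\epsilon}\big)$ described in the context is tight up to an $\mathcal{O}(\ln^2(\Delta_f/\sqrt\epsilon))$ factor. (iv) Let $\mathrm{Lev}(0):=\{x:f(x)\le f(0)\}$ be a level set; then $\mathcal{L}_1(\mathrm{Lev}(0))\ge\Delta^{d-2}\epsilon^{-200(d-2)}$. For any ball $B(0,R)$ with $R\ge\Omega(\Delta)$, one has $\mathcal{L}_1(B(0,R))\le\mathcal{O}(R^{d-2})$.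
   Context: Norms are Euclidean, $B(x,r)$ is the ball of radius $r$ centered at $x$, and for a compact set $C$, $\mathcal{L}_1(C)$ denotes the Lipschitz constant of $\nabla f$ on $C$ (assumed without loss of generality to be at least $1$). Definition of the family: $r(z)=\frac{1}{2+\ln(1+z^2)}$, $$a_{\Delta,\epsilon}=-\tfrac12r'\big(\tfrac{\Delta}{\epsilon^{200}}-1\big),\qquad b_{\Delta,\epsilon}=r\big(\tfrac{\Delta}{\epsilon^{200}}-1\big)+\tfrac12r'\big(\tfrac{\Delta}{\epsilon^{200}}-1\big)$$ (where $200$ is an arbitrary exponent), $$g_{\Delta,\epsilon}(x_1)=\begin{cases}r(1)+r'(1)(x_1-1),&x_1\le1,\\ r(x_1),&1<x_1<\frac{\Delta}{\epsilon^{200}}-1,\\ a_{\Delta,\epsilon}\big(x_1-\frac{\Delta}{\epsilon^{200}}\big)^2+b_{\Delta,\epsilon},&x_1\ge\frac{\Delta}{\epsilon^{200}}-1,\end{cases}$$ $$f_{\Delta,\epsilon}(x_1,x_2)=\Delta\,g_{\Delta,\epsilon}(x_1)+(x_1^{d-2}+1)x_2^2 .$$ The radius $R_T$: the sequential local optimization (SLO) algorithms run a first-order subroutine in epochs; each epoch uses local Lipschitz constants on a ball of radius $D$ around the epoch's first point, keeps its iterates within that ball, and ends when an iterate comes close enough to its boundary, that iterate becoming the first point of the next epoch; the algorithm stops once a point with gradient norm below $\sqrt\epsilon$ is found. $R_T$ denotes the radius of a ball around the initial point that contains all iterates until an $\epsilon$-stationary point is found (i.e. a point with $\|\nabla f\|^2\le\epsilon$),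 and the convergence analysis of these algorithms gives $R_T\le\mathcal{O}(\Delta_f/\sqrt\epsilon)$. *)

(* Defs.v *)
(* Stdlib reals with Coquelicot. *)
From Stdlib Require Import Reals Arith.
From Coquelicot Require Export Coquelicot.
Open Scope R_scope.

(* Points of R^2 are pairs. Coquelicot's [norm] on a product of normed modules
   is sqrt (norm (fst p) ^ 2 + norm (snd p) ^ 2), so on R * R it is the
   Euclidean norm. *)

Definition grad (f : R * R -> R) (p : R * R) : R * R :=
  (Derive (fun u : R => f (u, snd p)) (fst p),
   Derive (fun v : R => f (fst p, v)) (snd p)).

(* [Derive] is total; Frechet differentiability is what makes [grad f] the
   gradient of [f]. *)
Definition cont_differentiable (f : R * R -> R) : Prop :=
  (forall p : R * R, ex_filterdiff f (locally p)) /\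
  (forall p : R * R, continuous (grad f) p).

Definition coercive (f : R * R -> R) : Prop :=
  forall A : R, exists B : R, forall p : R * R, B < norm p -> A < f p.

Definition bounded_level_sets (f : R * R -> R) : Prop :=
  forall A : R, exists B : R, forall p : R * R, f p <= A -> norm p <= B.

Definition unique_minimizer (f : R * R -> R) (xs : R * R) : Prop :=
  (forall p : R * R, f xs <= f p) /\
  (forall p : R * R, (forall q : R * R, f p <= f q) -> p = xs).

Definition eps_stationary (f : R * R -> R) (eps : R) (p : R * R) : Prop :=
  norm (grad f p) ^ 2 <= eps.

Definition closed_ball (c : R * R) (rad : R) (p : R * R) : Prop :=
  norm (minus p c) <= rad.

Definition level_set (f : R * R -> R) (p0 p : R * R) : Prop := f p <= f p0.

(* The least Lipschitz constant, among those that are at least 1, of the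
   gradient on [C]; it is [p_infty] when the gradient is not Lipschitz on [C]. *)
Definition lip_grad (f : R * R -> R) (C : R * R -> Prop) : Rbar :=
  Glb_Rbar (fun L : R =>
    1 <= L /\
    forall p q : R * R, C p -> C q ->
      norm (minus (grad f p) (grad f q)) <= L * norm (minus p q)).

(* [RT] is the radius of a ball around the initial point [x 0] that contains
   the iterates [x 0, ..., x T], where [T] is the first index at which an
   eps-stationary point is found. Nothing else is required of the method that
   produced [x]. *)
Definition iterates_radius (f : R * R -> R) (eps : R) (x : nat -> R * R)
    (RT : R) : Prop :=
  exists T : nat,
    eps_stationary f eps (x T) /\
    (forall t : nat, (t < T)%nat -> ~ eps_stationary f eps (x t)) /\
    (forall t : nat, (t <= T)%nat -> closed_ball (x 0%nat) RT (x t)).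

Definition r (z : R) : R := / (2 + ln (1 + z ^ 2)).

Definition x1_opt (Delta eps : R) : R := Delta / eps ^ 200.

Definition a_coef (Delta eps : R) : R :=
  - (1 / 2) * Derive r (x1_opt Delta eps - 1).

Definition b_coef (Delta eps : R) : R :=
  r (x1_opt Delta eps - 1) + 1 / 2 * Derive r (x1_opt Delta eps - 1).

Definition g_fun (Delta eps x1 : R) : R :=
  if Rle_dec x1 1 then r 1 + Derive r 1 * (x1 - 1)
  else if Rlt_dec x1 (x1_opt Delta eps - 1) then r x1
  else a_coef Delta eps * (x1 - x1_opt Delta eps) ^ 2 + b_coef Delta eps.

Definition f_fun (d : nat) (Delta eps : R) (p : R * R) : R :=
  Delta * g_fun Delta eps (fst p) + (fst p ^ (d - 2) + 1) * snd p ^ 2.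

(* Main.v *)
Require Import Defs.
From Stdlib Require Import Reals Arith.
From Stdlib Require Import Lra Lia.
Open Scope R_scope.

(** The function is [Delta * g(x) + (x^n + 1) * y^2] with [n = d - 2] even. Its
    only hard feature is the profile [g], which follows [r] and hence flattens
    out along the ridge [y = 0]: there [|r'(x)|] is of order [1 / (x * ln(x)^2)].
    Everything is expressed through [u = Delta / sqrt eps >= 100].

    Far stationary points. If the gradient at [(x, y)] is at most [sqrt eps],
    its second component forces [(x^n + 1) * |y| <= sqrt eps / 2], so the
    coupling term [n * x^(n-1) * y^2] of the first component is [O(n * eps)] and
    [u * |g'(x)| <= n + 1] ([stationary_slope]). On the ridge this reads
    [u <= (n + 1) * x * (2 + ln(1 + x^2))^2], and for [x <= u] the logarithm is
    at most [6 * ln G] with [G = gap / sqrt eps] comparable to [u]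
    ([log_comparison]); hence [x] is at least of order [G / ln(G)^2]. On the
    linear piece [x <= 1] the slope is a constant of absolute value at least [1/9],
    which bounds [u] in terms of [n]; the estimate is then trivial unless [x] is close to
    [0], and close to [0] the coupling term is at most [eps / 4] whatever [n]
    is, which contradicts [u >= 100]. This is why the threshold [100] does not
    depend on [d] although the constant of the lower bound does
    ([stationary_far]).

    Lipschitz constants. The derivative of [g] is glued from Lipschitz pieces
    that agree at the two junctions, so it is 3-Lipschitz ([dg_lipschitz]); with
    the elementary Lipschitz bound for powers this controls the gradient on
    balls ([grad_lipschitz_on_ball]), which also gives its continuity. From
    below, moving from the minimizer in the direction of [y] changes the second
    component of the gradient at rate [2 * (X^n + 1)], where [X] is the abscissa
    of the minimizer, and a short such move stays in the level set of [0]
    ([lip_grad_level_set_lower]). *)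

(** * The profile r *)

Definition dr (z : R) : R := - (2 * z / (1 + z ^ 2)) * r z ^ 2.

Lemma ln_1_sqr_nonneg (z : R) : 0 <= ln (1 + z ^ 2).
Proof.
  rewrite <- ln_1; apply ln_le; [lra | nra].
Qed.

Lemma r_bounds (z : R) : 0 < r z <= 1 / 2.
Proof.
  unfold r; assert (H := ln_1_sqr_nonneg z); split.
  - apply Rinv_0_lt_compat; lra.
  - replace (1 / 2) with (/ 2) by field; apply Rinv_le_contravar; lra.
Qed.

Lemma is_derive_r (z : R) : is_derive r z (dr z).
Proof.
  unfold dr, r; assert (H := ln_1_sqr_nonneg z).
  assert (H0 : 0 < 1 + z ^ 2) by nra; simpl in *.
  auto_derive; [ repeat split; lra |].
  field; split; lra.
Qed.

Lemma Derive_r (z : R) : Derive r z = dr z.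
Proof.
  apply is_derive_unique, is_derive_r.
Qed.

Lemma ratio_bounds (z : R) : -1 <= 2 * z / (1 + z ^ 2) <= 1.
Proof.
  assert (0 < 1 + z ^ 2) by nra.
  assert (H1 := pow2_ge_0 (1 + z)); assert (H2 := pow2_ge_0 (1 - z)); split.
  - apply Rle_div_r; nra.
  - apply Rle_div_l; nra.
Qed.

Lemma dr_neg (z : R) : 0 < z -> dr z < 0.
Proof.
  intros Hz; unfold dr.
  assert (H := r_bounds z).
  assert (0 < 2 * z / (1 + z ^ 2)) by (apply Rdiv_lt_0_compat; nra).
  assert (0 < r z ^ 2) by nra.
  nra.
Qed.

Lemma dr_bound (z : R) : - r z ^ 2 <= dr z.
Proof.
  unfold dr; assert (H := ratio_bounds z).
  assert (0 <= r z ^ 2) by nra; nra.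
Qed.

Lemma dr_1 : dr 1 = - r 1 ^ 2.
Proof.
  unfold dr; field.
Qed.

Lemma r_1_lower : 1 / 3 <= r 1.
Proof.
  unfold r; replace (1 + 1 ^ 2) with 2 by ring.
  assert (H : ln 2 <= 1).
  { rewrite <- (ln_exp 1); apply ln_le; [lra |].
    left; replace 2 with (1 + 1) by ring; apply exp_ineq1; lra. }
  assert (H' : 0 < ln 2) by (rewrite <- ln_1; apply ln_increasing; lra).
  replace (1 / 3) with (/ 3) by field; apply Rinv_le_contravar; lra.
Qed.

Lemma r_decreasing (x y : R) : 0 <= x -> x <= y -> r y <= r x.
Proof.
  intros Hx Hy; unfold r; assert (H := ln_1_sqr_nonneg x).
  apply Rinv_le_contravar; [lra |].
  apply Rplus_le_compat_l, ln_le; nra.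
Qed.

(** With [q = 2z / (1 + z^2)] and [p = (1 - z^2) / (1 + z^2)^2], both of absolute
    value at most 1, the second derivative of [r] is [-2p * r^2 + 2q^2 * r^3],
    and [0 < r <= 1/2]. *)
Lemma dr_lipschitz (x y : R) : Rabs (dr x - dr y) <= 3 * Rabs (x - y).
Proof.
  apply bounded_variation with
    (dh := fun z => (- (2 * (1 - z ^ 2) / (1 + z ^ 2) ^ 2)) * r z ^ 2
                    + 2 * (2 * z / (1 + z ^ 2)) ^ 2 * r z ^ 3).
  intros z _; split.
  - unfold dr.
    assert (Hr := is_derive_r z).
    evar_last.
    + apply (is_derive_mult (fun z => - (2 * z / (1 + z ^ 2))) (fun z => r z ^ 2)).
      * auto_derive; [nra | reflexivity].
      * apply (is_derive_pow r 2); exact Hr.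
      * intros; apply Rmult_comm.
    + unfold plus, mult; simpl; unfold dr; simpl. field; nra.
  - assert (H := r_bounds z); assert (Hq := ratio_bounds z).
    set (q := 2 * z / (1 + z ^ 2)) in *.
    assert (Hp : -1 <= (1 - z ^ 2) / (1 + z ^ 2) ^ 2 <= 1).
    { assert (0 < (1 + z ^ 2) ^ 2) by nra; split;
      [ apply Rle_div_r | apply Rle_div_l ]; nra. }
    replace (2 * (1 - z ^ 2) / (1 + z ^ 2) ^ 2)
      with (2 * ((1 - z ^ 2) / (1 + z ^ 2) ^ 2)) by (field; nra).
    set (p := (1 - z ^ 2) / (1 + z ^ 2) ^ 2) in *.
    assert (0 <= q ^ 2 <= 1) by nra.
    assert (0 <= r z ^ 2 <= 1 / 2) by nra.
    assert (0 <= r z ^ 3 <= 1 / 2) by (split; simpl in *; nra).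
    apply Rabs_le; split; nra.
Qed.

(** * Gluing functions at a point *)

Lemma is_derive_paste (h A B : R -> R) (c x l : R) :
  (forall y, y <= c -> h y = A y) -> (forall y, c <= y -> h y = B y) ->
  (x <= c -> is_derive A x l) -> (c <= x -> is_derive B x l) ->
  is_derive h x l.
Proof.
  intros hA hB dA dB.
  destruct (Rtotal_order x c) as [Hx | [Hx | Hx]].
  - apply is_derive_ext_loc with A; [| apply dA; lra].
    assert (Hd : 0 < c - x) by lra.
    exists (mkposreal _ Hd); intros y Hy.
    symmetry; apply hA.
    apply Rabs_lt_between' in Hy; simpl in Hy; lra.
  - subst x; apply is_derive_Reals; intros e He.
    destruct (proj1 (is_derive_Reals _ _ _) (dA (Rle_refl c)) e He) as [a Ha].
    destruct (proj1 (is_derive_Reals _ _ _) (dB (Rle_refl c)) e He) as [b Hb].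
    exists (mkposreal _ (Rmin_stable_in_posreal a b)); simpl; intros k Hk Hkd.
    assert (H1 := Rmin_l a b); assert (H2 := Rmin_r a b).
    destruct (Rle_dec k 0) as [Hs | Hs].
    + rewrite (hA (c + k)), (hA c) by lra; apply Ha; [exact Hk | lra].
    + rewrite (hB (c + k)), (hB c) by lra; apply Hb; [exact Hk | lra].
  - apply is_derive_ext_loc with B; [| apply dB; lra].
    assert (Hd : 0 < x - c) by lra.
    exists (mkposreal _ Hd); intros y Hy.
    symmetry; apply hB.
    apply Rabs_lt_between' in Hy; simpl in Hy; lra.
Qed.

(** For points on opposite sides of [c], passing through [c] costs nothing,
    because distances on a line add up. *)
Lemma lipschitz_paste (h A B : R -> R) (c M : R) :
  (forall y, y <= c -> h y = A y) -> (forall y, c <= y -> h y = B y) ->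
  (forall x y, Rabs (A x - A y) <= M * Rabs (x - y)) ->
  (forall x y, Rabs (B x - B y) <= M * Rabs (x - y)) ->
  forall x y, Rabs (h x - h y) <= M * Rabs (x - y).
Proof.
  intros hA hB lA lB.
  assert (Hlt : forall x y, x <= c -> c <= y ->
                Rabs (h x - h y) <= M * Rabs (x - y)).
  { intros x y Hx Hy.
    replace (h x - h y) with ((h x - h c) + (h c - h y)) by ring.
    eapply Rle_trans; [apply Rabs_triang |].
    assert (H1 := lA x c); assert (H2 := lB c y).
    rewrite <- (hA x), <- (hA c) in H1 by lra.
    rewrite <- (hB c), <- (hB y) in H2 by lra.
    rewrite (Rabs_left1 (x - c)) in H1 by lra.
    rewrite (Rabs_left1 (c - y)) in H2 by lra.
    rewrite (Rabs_left1 (x - y)) by lra; lra. }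
  intros x y.
  destruct (Rle_dec x c) as [Hx | Hx]; destruct (Rle_dec y c) as [Hy | Hy].
  - rewrite !hA by assumption; apply lA.
  - apply Hlt; lra.
  - rewrite Rabs_minus_sym, (Rabs_minus_sym x); apply Hlt; lra.
  - rewrite !hB by lra; apply lB.
Qed.

(** * The piecewise function g *)

Definition dg (Delta eps x : R) : R :=
  if Rle_dec x 1 then dr 1
  else if Rlt_dec x (x1_opt Delta eps - 1) then dr x
  else 2 * a_coef Delta eps * (x - x1_opt Delta eps).

(** This choice of the quadratic coefficient makes the slopes of the last two
    pieces agree at their junction. *)
Lemma a_coef_eq (Delta eps : R) :
  2 * a_coef Delta eps = - dr (x1_opt Delta eps - 1).
Proof.
  unfold a_coef; rewrite Derive_r; field.
Qed.

Lemma b_coef_eq (Delta eps : R) :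
  b_coef Delta eps = r (x1_opt Delta eps - 1) + 1 / 2 * dr (x1_opt Delta eps - 1).
Proof.
  unfold b_coef; rewrite Derive_r; reflexivity.
Qed.

Lemma is_derive_g (Delta eps x : R) :
  2 < x1_opt Delta eps -> is_derive (g_fun Delta eps) x (dg Delta eps x).
Proof.
  intros HX.
  assert (Ha := a_coef_eq Delta eps); assert (Hb := b_coef_eq Delta eps).
  apply is_derive_paste with (c := x1_opt Delta eps - 1)
    (A := fun x => if Rle_dec x 1 then r 1 + dr 1 * (x - 1) else r x)
    (B := fun x => a_coef Delta eps * (x - x1_opt Delta eps) ^ 2
                   + b_coef Delta eps).
  - intros y Hy; unfold g_fun; rewrite Derive_r.
    destruct (Rle_dec y 1); [reflexivity |].
    destruct (Rlt_dec y (x1_opt Delta eps - 1)); [reflexivity |].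
    replace y with (x1_opt Delta eps - 1) by lra; simpl; lra.
  - intros y Hy; unfold g_fun.
    destruct (Rle_dec y 1); [lra |].
    destruct (Rlt_dec y (x1_opt Delta eps - 1)); [lra | reflexivity].
  - intros Hx; apply is_derive_paste with (c := 1) (B := r)
      (A := fun x => r 1 + dr 1 * (x - 1)).
    + intros y Hy; destruct (Rle_dec y 1); [reflexivity | lra].
    + intros y Hy; destruct (Rle_dec y 1); [| reflexivity].
      replace y with 1 by lra; ring.
    + intros Hx1; unfold dg; destruct (Rle_dec x 1); [| lra].
      auto_derive; [exact I | ring].
    + intros Hx1; evar_last; [apply is_derive_r |]; unfold dg.
      destruct (Rle_dec x 1); [f_equal; lra |].
      destruct (Rlt_dec x (x1_opt Delta eps - 1)); [reflexivity |].
      replace x with (x1_opt Delta eps - 1) by lra; lra.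
  - intros Hx; unfold dg; destruct (Rle_dec x 1); [lra |].
    destruct (Rlt_dec x (x1_opt Delta eps - 1)); [lra |].
    auto_derive; [exact I | ring].
Qed.

Lemma a_coef_bounds (Delta eps : R) :
  2 < x1_opt Delta eps -> 0 < 2 * a_coef Delta eps <= 3.
Proof.
  intros HX; rewrite a_coef_eq.
  assert (H := dr_neg (x1_opt Delta eps - 1) ltac:(lra)).
  assert (H1 := dr_bound (x1_opt Delta eps - 1)).
  assert (H2 := r_bounds (x1_opt Delta eps - 1)); nra.
Qed.

Lemma dg_lipschitz (Delta eps : R) :
  2 < x1_opt Delta eps ->
  forall x y, Rabs (dg Delta eps x - dg Delta eps y) <= 3 * Rabs (x - y).
Proof.
  intros HX.
  assert (Ha := a_coef_eq Delta eps); assert (Hb := a_coef_bounds _ _ HX).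
  apply lipschitz_paste with (c := x1_opt Delta eps - 1)
    (A := fun x => if Rle_dec x 1 then dr 1 else dr x)
    (B := fun x => 2 * a_coef Delta eps * (x - x1_opt Delta eps)).
  - intros y Hy; unfold dg; destruct (Rle_dec y 1); [reflexivity |].
    destruct (Rlt_dec y (x1_opt Delta eps - 1)); [reflexivity |].
    replace y with (x1_opt Delta eps - 1) by lra; lra.
  - intros y Hy; unfold dg; destruct (Rle_dec y 1); [lra |].
    destruct (Rlt_dec y (x1_opt Delta eps - 1)); [lra | reflexivity].
  - apply lipschitz_paste with (c := 1) (A := fun _ => dr 1) (B := dr).
    + intros y Hy; destruct (Rle_dec y 1); [reflexivity | lra].
    + intros y Hy; destruct (Rle_dec y 1); [f_equal; lra | reflexivity].
    + intros x y; rewrite Rminus_diag, Rabs_R0.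
      assert (H := Rabs_pos (x - y)); lra.
    + exact dr_lipschitz.
  - intros x y.
    replace (2 * a_coef Delta eps * (x - x1_opt Delta eps) -
             2 * a_coef Delta eps * (y - x1_opt Delta eps))
      with (2 * a_coef Delta eps * (x - y)) by ring.
    rewrite Rabs_mult, (Rabs_pos_eq (2 * _)) by lra.
    apply Rmult_le_compat_r; [apply Rabs_pos | lra].
Qed.

Lemma g_at_0 (Delta eps : R) : g_fun Delta eps 0 = r 1 + r 1 ^ 2.
Proof.
  unfold g_fun; destruct (Rle_dec 0 1); [| lra].
  rewrite Derive_r, dr_1; ring.
Qed.

Lemma g_at_opt (Delta eps : R) :
  2 < x1_opt Delta eps ->
  g_fun Delta eps (x1_opt Delta eps) = b_coef Delta eps.
Proof.
  intros HX; unfold g_fun; destruct (Rle_dec _ 1); [lra |].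
  destruct (Rlt_dec _ _); [lra | ring].
Qed.

Lemma b_coef_bounds (Delta eps : R) :
  2 < x1_opt Delta eps -> 0 < b_coef Delta eps < r (x1_opt Delta eps - 1).
Proof.
  intros HX; rewrite b_coef_eq.
  assert (H := dr_neg (x1_opt Delta eps - 1) ltac:(lra)).
  assert (H1 := dr_bound (x1_opt Delta eps - 1)).
  assert (H2 := r_bounds (x1_opt Delta eps - 1)); nra.
Qed.

Lemma g_gt_b (Delta eps x : R) :
  2 < x1_opt Delta eps -> x <> x1_opt Delta eps ->
  b_coef Delta eps < g_fun Delta eps x.
Proof.
  intros HX Hx; assert (Hb := b_coef_bounds _ _ HX).
  assert (Ha := a_coef_bounds _ _ HX).
  unfold g_fun; rewrite Derive_r.
  destruct (Rle_dec x 1) as [Hx1 | Hx1];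
    [| destruct (Rlt_dec x (x1_opt Delta eps - 1)) as [Hx2 | Hx2]].
  - assert (H := r_decreasing 1 (x1_opt Delta eps - 1) ltac:(lra) ltac:(lra)).
    assert (H1 := dr_neg 1 ltac:(lra)); nra.
  - assert (H := r_decreasing x (x1_opt Delta eps - 1) ltac:(lra) ltac:(lra)).
    lra.
  - assert (0 < (x - x1_opt Delta eps) ^ 2) by (apply pow2_gt_0; lra); nra.
Qed.

(** The linear piece grows at rate [r 1 ^ 2 >= 1/9] to the left, the quadratic
    one dominates [a * (t - 1)] with [t] the distance to its vertex, and
    between them the left-hand side is nonpositive. *)
Lemma g_linear_growth (Delta eps : R) :
  2 < x1_opt Delta eps ->
  exists c, 0 < c /\
    forall x, c * (Rabs x - x1_opt Delta eps - 1) <= g_fun Delta eps x.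
Proof.
  intros HX; assert (Ha := a_coef_bounds _ _ HX).
  assert (Hb := b_coef_bounds _ _ HX).
  set (c := Rmin (a_coef Delta eps) (1 / 9)).
  assert (Hc1 : c <= a_coef Delta eps) by apply Rmin_l.
  assert (Hc2 : c <= 1 / 9) by apply Rmin_r.
  assert (Hc : 0 < c) by (apply Rmin_case; lra).
  exists c; split; [exact Hc |]; intros x.
  unfold g_fun; rewrite Derive_r, dr_1.
  assert (Hr := r_1_lower).
  destruct (Rle_dec x 1) as [Hx1 | Hx1];
    [| destruct (Rlt_dec x (x1_opt Delta eps - 1)) as [Hx2 | Hx2]].
  - assert (Hx : Rabs x - x1_opt Delta eps - 1 <= 1 - x)
      by (unfold Rabs; destruct (Rcase_abs x); lra).
    assert (c * (Rabs x - x1_opt Delta eps - 1) <= c * (1 - x)) by nra.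
    assert (c * (1 - x) <= r 1 ^ 2 * (1 - x))
      by (apply Rmult_le_compat_r; nra).
    lra.
  - assert (H := r_bounds x); rewrite Rabs_pos_eq by lra; nra.
  - rewrite Rabs_pos_eq by lra.
    set (t := x - x1_opt Delta eps) in *.
    assert (c * (t - 1) <= c * t ^ 2) by (apply Rmult_le_compat_l; nra).
    assert (c * t ^ 2 <= a_coef Delta eps * t ^ 2)
      by (apply Rmult_le_compat_r; nra).
    lra.
Qed.

(** * The plane with its Euclidean norm *)

Lemma norm_ge_fst (p : R * R) : Rabs (fst p) <= norm p.
Proof.
  exact (norm_le_prod_norm_1 p).
Qed.

Lemma norm_ge_snd (p : R * R) : Rabs (snd p) <= norm p.
Proof.
  exact (norm_le_prod_norm_2 p).
Qed.

Lemma norm_le_sum (p : R * R) : norm p <= Rabs (fst p) + Rabs (snd p).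
Proof.
  change (sqrt (Rabs (fst p) ^ 2 + Rabs (snd p) ^ 2)
          <= Rabs (fst p) + Rabs (snd p)).
  assert (H1 := Rabs_pos (fst p)); assert (H2 := Rabs_pos (snd p)).
  rewrite <- (sqrt_pow2 (Rabs (fst p) + Rabs (snd p))) by lra.
  apply sqrt_le_1_alt; nra.
Qed.

(** The factor [Rabs L + 1] in the proof is positive whatever the sign of [L]. *)
Lemma continuous_of_lipschitz (G : R * R -> R * R) (p : R * R) (L : R) :
  (forall q : R * R, norm (minus q p) <= 1 ->
     norm (minus (G q) (G p)) <= L * norm (minus q p)) ->
  continuous G p.
Proof.
  intros HL; apply filterlim_locally; intros e.
  apply (locally_le_locally_norm p).
  set (K := Rabs L + 1).
  assert (HK : 0 < K) by (assert (H := Rabs_pos L); unfold K; lra).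
  assert (Hd : 0 < Rmin 1 (e / K)).
  { apply Rmin_case; [lra |]; apply Rdiv_lt_0_compat; [apply cond_pos | exact HK]. }
  exists (mkposreal _ Hd).
  change (forall q : R * R, norm (minus q p) < Rmin 1 (e / K) ->
            ball (G p) e (G q)).
  intros q Hq.
  assert (H1 := Rmin_l 1 (e / K)); assert (H2 := Rmin_r 1 (e / K)).
  apply (prod_norm_compat1 (U := R_NormedModule) (V := R_NormedModule)).
  change (norm (minus (G q) (G p)) < e).
  apply Rle_lt_trans with (K * norm (minus q p)).
  - eapply Rle_trans; [apply HL; lra |].
    apply Rmult_le_compat_r; [apply norm_ge_0 |].
    assert (H := Rle_abs L); unfold K; lra.
  - rewrite Rmult_comm; apply Rlt_div_r; lra.
Qed.

(** * The gradient of f *)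

Definition dfx (d : nat) (Delta eps x y : R) : R :=
  Delta * dg Delta eps x + INR (d - 2) * x ^ (d - 3) * y ^ 2.

Definition dfy (d : nat) (x y : R) : R := 2 * (x ^ (d - 2) + 1) * y.

Lemma is_derive_f_fst (d : nat) (Delta eps x y : R) :
  2 < x1_opt Delta eps ->
  is_derive (fun u => f_fun d Delta eps (u, y)) x (dfx d Delta eps x y).
Proof.
  intros HX; unfold f_fun, dfx; simpl fst; simpl snd.
  assert (Hg := is_derive_g Delta eps x HX).
  evar_last.
  - apply (is_derive_plus (fun u => Delta * g_fun Delta eps u)
             (fun u => (u ^ (d - 2) + 1) * y ^ 2)).
    + apply is_derive_scal; exact Hg.
    + auto_derive; [exact I | reflexivity].
  - unfold plus; simpl; replace (d - 3)%nat with (Nat.pred (d - 2)) by lia; ring.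
Qed.

Lemma is_derive_f_snd (d : nat) (Delta eps x y : R) :
  is_derive (fun v => f_fun d Delta eps (x, v)) y (dfy d x y).
Proof.
  unfold f_fun, dfy; simpl fst; simpl snd.
  auto_derive; [exact I | ring].
Qed.

Lemma grad_f (d : nat) (Delta eps : R) (p : R * R) :
  2 < x1_opt Delta eps ->
  grad (f_fun d Delta eps) p
  = (dfx d Delta eps (fst p) (snd p), dfy d (fst p) (snd p)).
Proof.
  intros HX; unfold grad; f_equal; apply is_derive_unique.
  - apply is_derive_f_fst; exact HX.
  - apply is_derive_f_snd.
Qed.

Lemma pow_lipschitz (k : nat) (rad x y : R) :
  Rabs x <= rad -> Rabs y <= rad ->
  Rabs (x ^ S k - y ^ S k) <= INR (S k) * rad ^ k * Rabs (x - y).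
Proof.
  intros Hx Hy.
  assert (Hr : 0 <= rad) by (assert (H := Rabs_pos x); lra).
  induction k as [| k IH].
  - simpl; rewrite !Rmult_1_r, Rmult_1_l; apply Rle_refl.
  - replace (x ^ S (S k) - y ^ S (S k))
      with (x * (x ^ S k - y ^ S k) + y ^ S k * (x - y))
      by (simpl; ring).
    eapply Rle_trans; [apply Rabs_triang |].
    rewrite !Rabs_mult, <- RPow_abs.
    assert (H1 : Rabs y ^ S k <= rad ^ S k)
      by (apply pow_incr; split; [apply Rabs_pos | exact Hy]).
    assert (H0 := Rabs_pos (x - y)).
    assert (H2 : Rabs x * Rabs (x ^ S k - y ^ S k)
                 <= rad * (INR (S k) * rad ^ k * Rabs (x - y)))
      by (apply Rmult_le_compat; auto using Rabs_pos).
    assert (H3 : Rabs y ^ S k * Rabs (x - y) <= rad ^ S k * Rabs (x - y))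
      by (apply Rmult_le_compat_r; assumption).
    rewrite (S_INR (S k)).
    replace ((INR (S k) + 1) * rad ^ S k * Rabs (x - y))
      with (rad * (INR (S k) * rad ^ k * Rabs (x - y)) + rad ^ S k * Rabs (x - y))
      by (simpl; ring).
    lra.
Qed.

(** The terms come from the second derivatives: [n(n-1)] and [2n] from the first
    component of the coupling, [2n], [2] and the constant [2] from the
    second one, and [3 * Delta] from the profile. *)
Definition lip_bound (d : nat) (Delta rad : R) : R :=
  (INR (d - 2) ^ 2 + 3 * INR (d - 2) + 2) * rad ^ (d - 2) + 3 * Delta + 2.

Lemma grad_lipschitz_on_ball (d : nat) (Delta eps rad : R) :
  (4 <= d)%nat -> 0 <= Delta -> 2 < x1_opt Delta eps ->
  forall p q : R * R, norm p <= rad -> norm q <= rad ->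
    norm (minus (grad (f_fun d Delta eps) p) (grad (f_fun d Delta eps) q))
    <= lip_bound d Delta rad * norm (minus p q).
Proof.
  intros Hd HD HX p q Hp Hq.
  rewrite !grad_f by exact HX.
  eapply Rle_trans; [apply norm_le_sum |].
  assert (Hx := norm_ge_fst (minus p q)); assert (Hy := norm_ge_snd (minus p q)).
  assert (Hpx := norm_ge_fst p); assert (Hpy := norm_ge_snd p).
  assert (Hqx := norm_ge_fst q); assert (Hqy := norm_ge_snd q).
  set (N := norm (minus p q)) in *.
  destruct p as [x y]; destruct q as [u v].
  change (Rabs (x - u) <= N) in Hx; change (Rabs (y - v) <= N) in Hy.
  simpl fst in *; simpl snd in *.
  change (Rabs (dfx d Delta eps x y - dfx d Delta eps u v)
          + Rabs (dfy d x y - dfy d u v) <= lip_bound d Delta rad * N).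
  assert (HN : 0 <= N) by (assert (H := Rabs_pos (x - u)); lra).
  assert (Bx : Rabs x <= rad) by lra; assert (By : Rabs y <= rad) by lra.
  assert (Bu : Rabs u <= rad) by lra; assert (Bv : Rabs v <= rad) by lra.
  assert (Hr : 0 <= rad) by (assert (H := Rabs_pos x); lra).
  unfold dfx, dfy, lip_bound.
  replace (d - 2)%nat with (S (S (d - 4))) by lia.
  replace (d - 3)%nat with (S (d - 4)) by lia.
  set (m := (d - 4)%nat); set (c := INR (S (S m))).
  assert (Hc : 0 <= c) by apply pos_INR.
  assert (Em : INR (S m) = c - 1) by (unfold c; rewrite (S_INR (S m)); ring).
  assert (P1 := pow_lipschitz m rad x u Bx Bu).
  assert (P2 := pow_lipschitz (S m) rad x u Bx Bu).
  fold c in P2; rewrite Em in P1.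
  assert (Hm : 0 <= rad ^ m) by (apply pow_le; exact Hr).
  assert (H1 : Rabs (y ^ 2) <= rad ^ 2).
  { rewrite <- RPow_abs; apply pow_incr; split; [apply Rabs_pos | exact By]. }
  assert (H2 : Rabs (u ^ S m) <= rad ^ S m).
  { rewrite <- RPow_abs; apply pow_incr; split; [apply Rabs_pos | exact Bu]. }
  assert (H3 : Rabs (u ^ S (S m)) <= rad ^ S (S m)).
  { rewrite <- RPow_abs; apply pow_incr; split; [apply Rabs_pos | exact Bu]. }
  assert (H4 : Rabs (y ^ 2 - v ^ 2) <= 2 * rad * N).
  { assert (H := pow_lipschitz 1 rad y v By Bv); simpl INR in H.
    rewrite pow_1 in H.
    assert (0 <= 2 * rad) by lra.
    eapply Rle_trans; [exact H |].
    replace ((1 + 1) * rad) with (2 * rad) by ring.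
    apply Rmult_le_compat_l; assumption. }
  assert (Hg := dg_lipschitz Delta eps HX x u).
  assert (Hc1 : 0 <= c - 1) by (rewrite <- Em; apply pos_INR).
  assert (P1' : Rabs (x ^ S m - u ^ S m) <= (c - 1) * rad ^ m * N).
  { eapply Rle_trans; [exact P1 |]; apply Rmult_le_compat_l; [| exact Hx].
    apply Rmult_le_pos; assumption. }
  assert (Hm1 : 0 <= rad ^ S m) by (apply pow_le; exact Hr).
  assert (P2' : Rabs (x ^ S (S m) - u ^ S (S m)) <= c * rad ^ S m * N).
  { eapply Rle_trans; [exact P2 |]; apply Rmult_le_compat_l; [| exact Hx].
    apply Rmult_le_pos; assumption. }
  assert (T1 : Rabs (Delta * dg Delta eps x + c * x ^ S m * y ^ 2
                     - (Delta * dg Delta eps u + c * u ^ S m * v ^ 2))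
               <= Delta * (3 * N)
                  + c * ((c - 1) * rad ^ m * N * rad ^ 2 + rad ^ S m * (2 * rad * N))).
  { replace (Delta * dg Delta eps x + c * x ^ S m * y ^ 2
             - (Delta * dg Delta eps u + c * u ^ S m * v ^ 2))
      with (Delta * (dg Delta eps x - dg Delta eps u)
            + c * ((x ^ S m - u ^ S m) * y ^ 2 + u ^ S m * (y ^ 2 - v ^ 2)))
      by ring.
    eapply Rle_trans; [apply Rabs_triang |].
    rewrite !(Rabs_mult Delta), !(Rabs_mult c),
      (Rabs_pos_eq Delta), (Rabs_pos_eq c) by assumption.
    apply Rplus_le_compat; apply Rmult_le_compat_l; try assumption; [lra |].
    eapply Rle_trans; [apply Rabs_triang |].
    rewrite !Rabs_mult.
    apply Rplus_le_compat; apply Rmult_le_compat; auto using Rabs_pos. }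
  assert (T2 : Rabs (2 * (x ^ S (S m) + 1) * y - 2 * (u ^ S (S m) + 1) * v)
               <= 2 * (c * rad ^ S m * N * rad + (rad ^ S (S m) + 1) * N)).
  { replace (2 * (x ^ S (S m) + 1) * y - 2 * (u ^ S (S m) + 1) * v)
      with (2 * ((x ^ S (S m) - u ^ S (S m)) * y + (u ^ S (S m) + 1) * (y - v)))
      by ring.
    rewrite Rabs_mult, (Rabs_pos_eq 2) by lra.
    apply Rmult_le_compat_l; [lra |].
    eapply Rle_trans; [apply Rabs_triang |].
    rewrite !Rabs_mult.
    apply Rplus_le_compat; apply Rmult_le_compat; auto using Rabs_pos.
    eapply Rle_trans; [apply Rabs_triang |]; rewrite Rabs_R1; lra. }
  eapply Rle_trans; [apply Rplus_le_compat; [exact T1 | exact T2] |].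
  right; simpl; ring.
Qed.

(** Frechet differentiability follows from the existence of both partial
    derivatives once one of them is continuous. *)
Lemma f_cont_differentiable (d : nat) (Delta eps : R) :
  (4 <= d)%nat -> 0 <= Delta -> 2 < x1_opt Delta eps ->
  cont_differentiable (f_fun d Delta eps).
Proof.
  intros Hd HD HX.
  assert (Hc : forall p : R * R, continuous (grad (f_fun d Delta eps)) p).
  { intros p; apply continuous_of_lipschitz with
      (L := lip_bound d Delta (norm p + 1)).
    intros q Hq.
    assert (H : norm q <= norm p + norm (minus q p)).
    { replace (norm q) with (norm (plus p (minus q p))).
      - exact (norm_triangle
          (V := prod_NormedModule R_AbsRing R_NormedModule R_NormedModule)
          p (minus q p)).
      - f_equal; destruct p as [p1 p2], q as [q1 q2].
        change ((p1 + (q1 + - p1), p2 + (q2 + - p2)) = (q1, q2)).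
        f_equal; ring. }
    apply grad_lipschitz_on_ball; try assumption; lra. }
  split; [| exact Hc].
  intros [x y]; eexists.
  apply filterdiff_ext with
    (f := fun u => (fun a b => f_fun d Delta eps (a, b)) (fst u) (snd u)).
  { intros [a b]; reflexivity. }
  refine (is_derive_filterdiff (fun a b => f_fun d Delta eps (a, b)) x y
            (dfx d Delta eps) (dfy d x y) _ _ _).
  - apply filter_forall; intros u; apply is_derive_f_fst; exact HX.
  - apply is_derive_f_snd.
  - apply continuous_ext with (fun u => fst (grad (f_fun d Delta eps) u)).
    { intros u; rewrite grad_f by exact HX; reflexivity. }
    apply continuous_comp; [apply Hc | apply continuous_fst].
Qed.

(** * Growth, minimizer and function value gap *)

Lemma even_pow_nonneg (d : nat) (x : R) : Nat.Even d -> 0 <= x ^ (d - 2).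
Proof.
  intros [k Hk].
  replace (d - 2)%nat with (2 * (k - 1))%nat by lia.
  rewrite pow_mult; apply pow_le, pow2_ge_0.
Qed.

(** The minimizer is far beyond the scale [Delta / sqrt eps], because
    [eps ^ 200 <= eps <= sqrt eps / 2] when [eps <= 1/4]. *)
Lemma scales (Delta eps : R) :
  0 < eps -> eps <= 1 / 4 -> 100 * sqrt eps <= Delta ->
  0 < sqrt eps <= 1 / 2 /\ 100 <= Delta / sqrt eps /\
  2 * (Delta / sqrt eps) <= x1_opt Delta eps.
Proof.
  intros He He4 HD.
  assert (Hs : 0 < sqrt eps) by (apply sqrt_lt_R0; exact He).
  assert (E : sqrt eps * sqrt eps = eps) by (apply sqrt_sqrt; lra).
  assert (Hs2 : sqrt eps <= 1 / 2) by nra.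
  split; [lra | split].
  - apply (proj1 (Rle_div_r 100 Delta _ Hs)); exact HD.
  - unfold x1_opt.
    assert (Hp : 0 < eps ^ 200) by (apply pow_lt; exact He).
    assert (Hp1 : eps ^ 200 <= eps).
    { change (eps ^ 200) with (eps * eps ^ 199).
      assert (eps ^ 199 <= 1 ^ 199) by (apply pow_incr; lra).
      rewrite pow1 in H; nra. }
    set (P := eps ^ 200) in *; clearbody P.
    replace (2 * (Delta / sqrt eps)) with (Delta * (2 / sqrt eps)) by (field; lra).
    unfold Rdiv at 2; apply Rmult_le_compat_l; [lra |].
    apply Rle_div_l; [lra |].
    replace (/ P * sqrt eps) with (sqrt eps / P) by (field; lra).
    apply Rle_div_r; [exact Hp |].
    assert (sqrt eps * sqrt eps <= sqrt eps * (1 / 2))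
      by (apply Rmult_le_compat_l; lra).
    lra.
Qed.

Lemma f_linear_growth (d : nat) (Delta eps : R) :
  Nat.Even d -> 0 < Delta -> 2 < x1_opt Delta eps ->
  exists c k, 0 < c /\
    forall p : R * R, c * norm p <= f_fun d Delta eps p + k.
Proof.
  intros Hd HD HX.
  destruct (g_linear_growth _ _ HX) as [c0 [Hc0 Hg]].
  assert (HDc : 0 < Delta * c0) by nra.
  set (c := Rmin (Delta * c0) 1).
  assert (Hc1 : c <= Delta * c0) by apply Rmin_l.
  assert (Hc2 : c <= 1) by apply Rmin_r.
  assert (Hc : 0 < c) by (apply Rmin_case; lra).
  exists c, (Delta * c0 * (x1_opt Delta eps + 1) + 1); split; [exact Hc |].
  intros [x y]; assert (HN := norm_le_sum (x, y)); simpl fst in HN; simpl snd in HN.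
  unfold f_fun; simpl fst; simpl snd.
  assert (Hx := Hg x); assert (Hn := even_pow_nonneg d x Hd).
  assert (Hy0 := Rabs_pos y); assert (Hx0 := Rabs_pos x).
  assert (Ey : y ^ 2 = Rabs y ^ 2) by (rewrite pow2_abs; reflexivity).
  assert (Y1 : c * Rabs y <= Rabs y) by nra.
  assert (Y2 : Rabs y <= Rabs y ^ 2 + 1) by nra.
  assert (Y3 : y ^ 2 <= (x ^ (d - 2) + 1) * y ^ 2).
  { assert (0 <= y ^ 2) by apply pow2_ge_0; nra. }
  assert (X1 : c * Rabs x <= Delta * c0 * Rabs x) by (apply Rmult_le_compat_r; assumption).
  assert (X2 : Delta * (c0 * (Rabs x - x1_opt Delta eps - 1))
               <= Delta * g_fun Delta eps x)
    by (apply Rmult_le_compat_l; lra).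
  assert (N1 : c * norm (x, y) <= c * (Rabs x + Rabs y))
    by (apply Rmult_le_compat_l; lra).
  lra.
Qed.

Lemma f_coercive (d : nat) (Delta eps : R) :
  Nat.Even d -> 0 < Delta -> 2 < x1_opt Delta eps ->
  coercive (f_fun d Delta eps) /\ bounded_level_sets (f_fun d Delta eps).
Proof.
  intros Hd HD HX.
  destruct (f_linear_growth d Delta eps Hd HD HX) as [c [k [Hc H]]].
  split; intros A; exists ((A + k) / c); intros p Hp; specialize (H p).
  - apply Rlt_div_l in Hp; [lra | exact Hc].
  - apply Rle_div_r; [exact Hc | lra].
Qed.

Lemma f_at_opt (d : nat) (Delta eps : R) :
  2 < x1_opt Delta eps ->
  f_fun d Delta eps (x1_opt Delta eps, 0) = Delta * b_coef Delta eps.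
Proof.
  intros HX; unfold f_fun; simpl fst; simpl snd.
  rewrite g_at_opt by exact HX; ring.
Qed.

Lemma f_unique_minimizer (d : nat) (Delta eps : R) :
  Nat.Even d -> 0 < Delta -> 2 < x1_opt Delta eps ->
  unique_minimizer (f_fun d Delta eps) (x1_opt Delta eps, 0).
Proof.
  intros Hd HD HX.
  assert (Hmin : forall p, p <> (x1_opt Delta eps, 0) ->
            f_fun d Delta eps (x1_opt Delta eps, 0) < f_fun d Delta eps p).
  { intros [x y] Hne; rewrite f_at_opt by exact HX.
    unfold f_fun; simpl fst; simpl snd.
    assert (Hn := even_pow_nonneg d x Hd); assert (Hy := pow2_ge_0 y).
    destruct (Req_dec x (x1_opt Delta eps)) as [-> | Hx].
    - assert (Hy' : y <> 0) by (intros ->; apply Hne; reflexivity).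
      apply pow2_gt_0 in Hy'; rewrite g_at_opt by exact HX; nra.
    - assert (H := g_gt_b _ _ _ HX Hx); nra. }
  assert (Hdec : forall p, p = (x1_opt Delta eps, 0) \/ p <> (x1_opt Delta eps, 0)).
  { intros [x y]; destruct (Req_dec x (x1_opt Delta eps)) as [-> | Hx].
    - destruct (Req_dec y 0) as [-> | Hy]; [left; reflexivity |].
      right; intros E; injection E; exact Hy.
    - right; intros E; injection E; intros _; exact Hx. }
  split; intros p.
  - destruct (Hdec p) as [-> | Hp]; [apply Rle_refl | left; apply Hmin, Hp].
  - intros Hp; destruct (Hdec p) as [E | Hne]; [exact E |].
    specialize (Hp (x1_opt Delta eps, 0)); apply Hmin in Hne; lra.
Qed.

Lemma gap_bounds (d : nat) (Delta eps : R) :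
  0 < Delta -> 2 < x1_opt Delta eps ->
  1 / 9 * Delta
  <= f_fun d Delta eps (0, 0) - f_fun d Delta eps (x1_opt Delta eps, 0)
  <= 1 * Delta.
Proof.
  intros HD HX; rewrite f_at_opt by exact HX.
  replace (f_fun d Delta eps (0, 0)) with (Delta * (r 1 + r 1 ^ 2)).
  2:{ unfold f_fun; simpl fst; simpl snd; rewrite g_at_0; ring. }
  assert (Hb := b_coef_bounds _ _ HX).
  assert (H := r_decreasing 1 (x1_opt Delta eps - 1) ltac:(lra) ltac:(lra)).
  assert (H1 := r_1_lower); assert (H2 := r_bounds 1).
  assert (1 / 9 <= r 1 + r 1 ^ 2 - b_coef Delta eps <= 1) by nra.
  nra.
Qed.

(** * Stationary points *)

(** The square of [(X + 1) * |y| <= s / 2] absorbs the factor [X + 1] allowed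
    for [c], since [X + 1 <= (X + 1)^2]. *)
Lemma cross_term_bound (n c X y s : R) :
  0 <= X -> 0 <= n -> Rabs c <= n * (X + 1) -> Rabs (2 * (X + 1) * y) <= s ->
  Rabs (c * y ^ 2) <= n * s ^ 2 / 4.
Proof.
  intros HX Hn Hc Hy.
  assert (Hy0 := Rabs_pos y).
  rewrite Rabs_mult, <- RPow_abs.
  rewrite Rabs_mult, (Rabs_pos_eq (2 * (X + 1))) in Hy by lra.
  assert (Hq : ((X + 1) * Rabs y) ^ 2 <= (s / 2) ^ 2) by (apply pow_incr; nra).
  assert (H1 : Rabs c * Rabs y ^ 2 <= n * (X + 1) * Rabs y ^ 2)
    by (apply Rmult_le_compat_r; [apply pow2_ge_0 | exact Hc]).
  assert (H2 : n * (X + 1) * Rabs y ^ 2 <= n * ((X + 1) * Rabs y) ^ 2).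
  { rewrite Rmult_assoc; apply Rmult_le_compat_l; [exact Hn |].
    assert (0 <= Rabs y ^ 2) by apply pow2_ge_0; nra. }
  assert (H3 : n * ((X + 1) * Rabs y) ^ 2 <= n * (s / 2) ^ 2)
    by (apply Rmult_le_compat_l; assumption).
  lra.
Qed.

Lemma Rabs_pow_pred_le (n : nat) (x : R) :
  0 <= x ^ S n -> Rabs (x ^ n) <= x ^ S n + 1.
Proof.
  intros H; rewrite <- (Rabs_pos_eq (x ^ S n)) by exact H.
  rewrite <- !RPow_abs.
  assert (Hx := Rabs_pos x).
  destruct (Rle_dec (Rabs x) 1) as [H1 | H1].
  - assert (Rabs x ^ n <= 1 ^ n) by (apply pow_incr; lra).
    assert (0 <= Rabs x ^ S n) by (apply pow_le; lra).
    rewrite pow1 in *; lra.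
  - assert (0 <= Rabs x ^ n) by (apply pow_le; lra).
    simpl; nra.
Qed.

(** The coefficient [n] of the coupling term is beaten by [2^(n-1)], which makes
    the estimate near the origin uniform in the degree. *)
Lemma INR_mul_half_pow (n : nat) (x : R) :
  Rabs x <= 1 / 2 -> INR (S (S n)) * Rabs x ^ S n <= 1.
Proof.
  intros Hx; assert (Hx0 := Rabs_pos x).
  induction n as [| n IH]; [simpl; lra |].
  assert (Hp : 0 <= Rabs x ^ S n) by (apply pow_le; exact Hx0).
  assert (H1 : 2 <= INR (S (S n))) by (rewrite !S_INR; assert (H := pos_INR n); lra).
  rewrite S_INR.
  change (Rabs x ^ S (S n)) with (Rabs x * Rabs x ^ S n); nra.
Qed.

(** The coupling term is bounded through the second component of the gradient,
    with the factor [n] in general and the factor [1] near the origin. *)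
Lemma stationary_slope (d : nat) (Delta eps x y : R) :
  Nat.Even d -> (4 <= d)%nat ->
  0 < eps -> eps <= 1 / 4 -> 100 * sqrt eps <= Delta ->
  eps_stationary (f_fun d Delta eps) eps (x, y) ->
  Delta / sqrt eps * Rabs (dg Delta eps x) <= INR (d - 2) + 1 /\
  (Rabs x <= 1 / 2 -> Delta / sqrt eps * Rabs (dg Delta eps x) <= 2).
Proof.
  intros Hev Hd He He4 HD Hst.
  destruct (scales _ _ He He4 HD) as [Hs [Hu HX]].
  unfold eps_stationary in Hst; rewrite grad_f in Hst by lra.
  simpl fst in Hst; simpl snd in Hst.
  set (N := norm (dfx d Delta eps x y, dfy d x y)) in Hst.
  assert (N1 : Rabs (dfx d Delta eps x y) <= N)
    by exact (norm_ge_fst (dfx d Delta eps x y, dfy d x y)).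
  assert (N2 : Rabs (dfy d x y) <= N)
    by exact (norm_ge_snd (dfx d Delta eps x y, dfy d x y)).
  clearbody N.
  assert (E : sqrt eps * sqrt eps = eps) by (apply sqrt_sqrt; lra).
  set (s := sqrt eps) in *.
  assert (HNs : N <= s) by nra.
  assert (Hn := even_pow_nonneg d x Hev).
  unfold dfx in N1; unfold dfy in N2.
  assert (Hslope : forall m, 0 <= m ->
            Rabs (INR (d - 2) * x ^ (d - 3)) <= m * (x ^ (d - 2) + 1) ->
            Delta / s * Rabs (dg Delta eps x) <= 1 + m).
  { intros m Hm Hc.
    assert (H := cross_term_bound m (INR (d - 2) * x ^ (d - 3)) (x ^ (d - 2)) y s
                   Hn Hm Hc ltac:(lra)).
    assert (T : Rabs (Delta * dg Delta eps x) <= s + m * s ^ 2 / 4).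
    { replace (Delta * dg Delta eps x)
        with (Delta * dg Delta eps x + INR (d - 2) * x ^ (d - 3) * y ^ 2
              - INR (d - 2) * x ^ (d - 3) * y ^ 2) by ring.
      eapply Rle_trans; [apply Rabs_triang |]; rewrite Rabs_Ropp; lra. }
    rewrite Rabs_mult, (Rabs_pos_eq Delta) in T by lra.
    replace (Delta / s * Rabs (dg Delta eps x))
      with (Delta * Rabs (dg Delta eps x) / s) by (field; lra).
    apply Rle_div_l; [lra |].
    assert (m * (s ^ 2 / 4) <= m * s) by (apply Rmult_le_compat_l; nra).
    lra. }
  split; [| intros Hx].
  - rewrite Rplus_comm; apply Hslope; [apply pos_INR |].
    rewrite Rabs_mult, Rabs_pos_eq by apply pos_INR.
    apply Rmult_le_compat_l; [apply pos_INR |].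
    replace (d - 2)%nat with (S (d - 3)) in * by lia.
    apply Rabs_pow_pred_le; exact Hn.
  - replace 2 with (1 + 1) by ring; apply Hslope; [lra |].
    rewrite Rabs_mult, Rabs_pos_eq, <- RPow_abs by apply pos_INR.
    replace (INR (d - 2)) with (INR (S (S (d - 4)))) by (f_equal; lia).
    replace (d - 3)%nat with (S (d - 4)) by lia.
    assert (H := INR_mul_half_pow (d - 4) x Hx); lra.
Qed.

Lemma dr_lower (x : R) : 1 <= x -> r x ^ 2 <= x * Rabs (dr x).
Proof.
  intros Hx.
  assert (Hd := dr_neg x ltac:(lra)); rewrite Rabs_left by exact Hd.
  unfold dr.
  replace (x * - (- (2 * x / (1 + x ^ 2)) * r x ^ 2))
    with (2 * x ^ 2 / (1 + x ^ 2) * r x ^ 2) by (field; nra).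
  assert (H : 1 <= 2 * x ^ 2 / (1 + x ^ 2)) by (apply Rle_div_r; nra).
  assert (0 <= r x ^ 2) by apply pow2_ge_0; nra.
Qed.

Lemma ln_10_lower (G : R) : 10 <= G -> 2 <= ln G.
Proof.
  intros HG; rewrite <- (ln_exp 2); apply ln_le; [apply exp_pos |].
  replace 2 with (1 + 1) by ring; rewrite exp_plus.
  assert (H := exp_le_3); assert (H0 := exp_pos 1); nra.
Qed.

(** [x <= 9 * G <= G^2] gives [1 + x^2 <= G^5], and [2 <= ln G] absorbs the
    constant. *)
Lemma log_comparison (G u x : R) :
  10 <= G -> u <= 9 * G -> 1 <= x -> x <= u -> 2 + ln (1 + x ^ 2) <= 6 * ln G.
Proof.
  intros HG HuG Hx Hxu.
  assert (Hl := ln_10_lower G HG).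
  assert (HxG : x <= G ^ 2) by nra.
  assert (H2 : x ^ 2 <= (G ^ 2) ^ 2) by (apply pow_incr; lra).
  assert (H3 : 1 + x ^ 2 <= G ^ 5).
  { assert (100 <= G ^ 2) by nra.
    assert (1 <= (G ^ 2) ^ 2) by nra.
    replace (G ^ 5) with (G * (G ^ 2) ^ 2) by ring; nra. }
  assert (H4 : ln (1 + x ^ 2) <= ln (G ^ 5)) by (apply ln_le; nra).
  rewrite ln_pow in H4 by lra; simpl INR in H4; lra.
Qed.

(** Three ranges of [x]. On the linear piece the slope has absolute value at least
    [1/9]: this is absurd when [|x| <= 1/2], and otherwise [G <= u <= 9(n + 1)],
    so the claimed lower bound is less than [1/2]. Beyond [u] the first
    coordinate alone is large enough, as [G <= u]. In between the profile is
    [r], whose slope has absolute value at least [r(x)^2 / x]. *)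
Lemma stationary_far (d : nat) (Delta eps G : R) (p : R * R) :
  Nat.Even d -> (4 <= d)%nat ->
  0 < eps -> eps <= 1 / 4 -> 100 * sqrt eps <= Delta ->
  Delta / sqrt eps <= 9 * G -> G <= Delta / sqrt eps ->
  eps_stationary (f_fun d Delta eps) eps p ->
  / (36 * (INR (d - 2) + 1)) * (G / ln G ^ 2) <= norm p.
Proof.
  intros Hev Hd He He4 HD HG1 HG2 Hst.
  destruct (scales _ _ He He4 HD) as [Hs [Hu HX]].
  destruct p as [x y].
  eapply Rle_trans; [| exact (norm_ge_fst (x, y))]; simpl fst.
  destruct (stationary_slope d Delta eps x y Hev Hd He He4 HD Hst) as [S1 S2].
  assert (Hn := pos_INR (d - 2)).
  set (u := Delta / sqrt eps) in *; set (n := INR (d - 2)) in *.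
  assert (Hl := ln_10_lower G ltac:(lra)).
  set (l := ln G) in *.
  assert (Hl4 : 4 <= l ^ 2) by nra.
  replace (/ (36 * (n + 1)) * (G / l ^ 2)) with (G / (36 * (n + 1) * l ^ 2))
    by (field; lra).
  assert (Hden : 144 * (n + 1) <= 36 * (n + 1) * l ^ 2) by nra.
  apply Rle_div_l; [lra |].
  assert (Hax : forall b, 0 <= b -> b <= Rabs x ->
            b * (36 * (n + 1) * l ^ 2) <= Rabs x * (36 * (n + 1) * l ^ 2))
    by (intros b Hb Hbx; apply Rmult_le_compat_r; lra).
  assert (Hr1 := r_1_lower).
  destruct (Rle_dec x 1) as [Hx1 | Hx1].
  - assert (Hdg : dg Delta eps x = - r 1 ^ 2).
    { unfold dg; destruct (Rle_dec x 1); [apply dr_1 | lra]. }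
    rewrite Hdg, Rabs_Ropp, (Rabs_pos_eq (r 1 ^ 2)) in S1, S2
      by apply pow2_ge_0.
    assert (Hu9 : u * (1 / 9) <= u * r 1 ^ 2) by (apply Rmult_le_compat_l; nra).
    destruct (Rle_dec (Rabs x) (1 / 2)) as [Hx | Hx].
    + specialize (S2 Hx); lra.
    + specialize (Hax (1 / 2) ltac:(lra) ltac:(lra)); lra.
  - rewrite (Rabs_pos_eq x) in Hax |- * by lra.
    destruct (Rle_dec u x) as [Hux | Hux].
    + specialize (Hax u ltac:(lra) Hux).
      assert (u * 1 <= u * (36 * (n + 1) * l ^ 2))
        by (apply Rmult_le_compat_l; lra).
      lra.
    + assert (Hdg : dg Delta eps x = dr x).
      { unfold dg; destruct (Rle_dec x 1); [lra |].
        destruct (Rlt_dec x (x1_opt Delta eps - 1)); [reflexivity | lra]. }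
      rewrite Hdg in S1.
      assert (Hlow := dr_lower x ltac:(lra)).
      assert (HL := log_comparison G u x ltac:(lra) HG1 ltac:(lra) ltac:(lra)).
      fold l in HL.
      assert (HL0 : 2 <= 2 + ln (1 + x ^ 2))
        by (assert (H := ln_1_sqr_nonneg x); lra).
      set (L := 2 + ln (1 + x ^ 2)) in *.
      assert (Hr : r x ^ 2 * L ^ 2 = 1) by (unfold r; fold L; field; lra).
      assert (HL2 : L ^ 2 <= (6 * l) ^ 2) by (apply pow_incr; lra).
      assert (T1 : u * r x ^ 2 <= x * (n + 1)).
      { apply Rle_trans with (x * (u * Rabs (dr x))).
        { rewrite <- Rmult_assoc, (Rmult_comm x), Rmult_assoc.
          apply Rmult_le_compat_l; lra. }
        apply Rmult_le_compat_l; lra. }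
      assert (T2 : u * r x ^ 2 * L ^ 2 <= x * (n + 1) * L ^ 2)
        by (apply Rmult_le_compat_r; [apply pow2_ge_0 | exact T1]).
      rewrite Rmult_assoc, Hr in T2.
      assert (T3 : x * (n + 1) * L ^ 2 <= x * (n + 1) * (6 * l) ^ 2)
        by (apply Rmult_le_compat_l; [nra | exact HL2]).
      lra.
Qed.

(** On the ridge the gradient is [Delta * r'(u)], and
    [u * |r'(u)| <= 2 * r(u)^2 <= 1]. *)
Lemma ridge_point_stationary (d : nat) (Delta eps : R) :
  0 < eps -> eps <= 1 / 4 -> 100 * sqrt eps <= Delta ->
  eps_stationary (f_fun d Delta eps) eps (Delta / sqrt eps, 0).
Proof.
  intros He He4 HD.
  destruct (scales _ _ He He4 HD) as [Hs [Hu HX]].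
  unfold eps_stationary; rewrite grad_f by lra; simpl fst; simpl snd.
  assert (E : sqrt eps * sqrt eps = eps) by (apply sqrt_sqrt; lra).
  assert (ED : Delta = Delta / sqrt eps * sqrt eps) by (field; lra).
  set (u := Delta / sqrt eps) in *; set (s := sqrt eps) in *.
  replace (dfx d Delta eps u 0) with (Delta * dr u).
  2:{ unfold dfx, dg; destruct (Rle_dec u 1); [lra |].
      destruct (Rlt_dec u (x1_opt Delta eps - 1)); [ring | lra]. }
  replace (dfy d u 0) with 0 by (unfold dfy; ring).
  assert (HN := norm_le_sum (Delta * dr u, 0)).
  simpl fst in HN; simpl snd in HN; rewrite Rabs_R0 in HN.
  assert (Hd := dr_neg u ltac:(lra)).
  rewrite Rabs_mult, Rabs_pos_eq, Rabs_left in HN by lra.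
  assert (Hud : u * - dr u <= 1).
  { unfold dr; assert (Hr := r_bounds u).
    replace (u * - (- (2 * u / (1 + u ^ 2)) * r u ^ 2))
      with (2 * u ^ 2 / (1 + u ^ 2) * r u ^ 2) by (field; nra).
    assert (2 * u ^ 2 / (1 + u ^ 2) <= 2) by (apply Rle_div_l; nra).
    assert (0 <= r u ^ 2 <= 1 / 4) by nra.
    apply Rle_trans with (2 * r u ^ 2); [apply Rmult_le_compat_r |]; lra. }
  assert (HDs : Delta * - dr u <= s) by (rewrite ED; nra).
  assert (HN0 : 0 <= norm (Delta * dr u, 0)) by apply norm_ge_0.
  set (N := norm (Delta * dr u, 0)) in *; clearbody N; nra.
Qed.

(** * Lipschitz constants of the gradient *)

(** The displacement [y] is chosen so that it uses up the guaranteed gap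
    [Delta / 9] exactly. *)
Lemma lip_grad_level_set_lower (d : nat) (Delta eps : R) :
  0 < Delta -> 2 < x1_opt Delta eps ->
  Rbar_le (x1_opt Delta eps ^ (d - 2))
    (lip_grad (f_fun d Delta eps) (level_set (f_fun d Delta eps) (0, 0))).
Proof.
  intros HD HX; apply (proj2 (Glb_Rbar_correct _)).
  intros L [_ HL]; simpl.
  assert (Hgap := gap_bounds d Delta eps HD HX).
  set (X := x1_opt Delta eps) in *.
  set (P := X ^ (d - 2) + 1).
  assert (HP : 1 <= P).
  { assert (0 <= X ^ (d - 2)) by (apply pow_le; lra); unfold P; lra. }
  set (y := sqrt (1 / 9 * Delta / P)).
  assert (Hq : 0 < 1 / 9 * Delta / P) by (apply Rdiv_lt_0_compat; lra).
  assert (Hy : 0 < y) by (apply sqrt_lt_R0; exact Hq).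
  assert (Ey : P * y ^ 2 = 1 / 9 * Delta).
  { unfold y; rewrite pow2_sqrt by lra; field; lra. }
  assert (Hlev : forall v, P * v ^ 2 <= 1 / 9 * Delta ->
            level_set (f_fun d Delta eps) (0, 0) (X, v)).
  { intros v Hv; unfold level_set.
    replace (f_fun d Delta eps (X, v))
      with (f_fun d Delta eps (X, 0) + P * v ^ 2); [lra |].
    unfold f_fun, P; simpl fst; simpl snd; ring. }
  specialize (HL (X, y) (X, 0) (Hlev y ltac:(lra))
                (Hlev 0 ltac:(rewrite pow_i by lia; lra))).
  rewrite !grad_f in HL by exact HX; simpl fst in HL; simpl snd in HL.
  assert (H1 := norm_ge_snd
    (minus (dfx d Delta eps X y, dfy d X y) (dfx d Delta eps X 0, dfy d X 0))).
  change (Rabs (dfy d X y - dfy d X 0)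
          <= norm (minus (dfx d Delta eps X y, dfy d X y)
                         (dfx d Delta eps X 0, dfy d X 0))) in H1.
  assert (H2 := norm_le_sum (minus (X, y) (X, 0))).
  change (norm (minus (X, y) (X, 0)) <= Rabs (X - X) + Rabs (y - 0)) in H2.
  rewrite Rminus_diag, Rabs_R0, Rminus_0_r, (Rabs_pos_eq y) in H2 by lra.
  replace (dfy d X y - dfy d X 0) with (2 * P * y) in H1
    by (unfold dfy, P; ring).
  rewrite Rabs_pos_eq in H1 by nra.
  assert (H0 : 0 <= norm (minus (X, y) (X, 0))) by apply norm_ge_0.
  set (N := norm (minus (X, y) (X, 0))) in *; clearbody N.
  assert (H3 : 2 * P * y <= L * N) by lra.
  assert (HL0 : 0 < L) by (assert (0 < 2 * P * y) by nra; nra).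
  assert (H4 : 2 * P * y <= L * y) by nra.
  apply Rmult_le_reg_r in H4; [unfold P in *; lra | exact Hy].
Qed.

(** The last two terms convert [3 * Delta] and [2] into multiples of
    [rad ^ (d - 2)], using [kappa * Delta <= rad] and
    [kappa * Delta0 <= rad]. *)
Definition ball_lip_factor (d : nat) (Delta0 kappa : R) : R :=
  (INR (d - 2) ^ 2 + 3 * INR (d - 2) + 2)
  + 3 / kappa / (kappa * Delta0) ^ (d - 3) + 2 / (kappa * Delta0) ^ (d - 2).

Lemma ball_lip_factor_pos (d : nat) (Delta0 kappa : R) :
  0 < Delta0 -> 0 < kappa -> 0 < ball_lip_factor d Delta0 kappa.
Proof.
  intros HD Hk; unfold ball_lip_factor; assert (Hn := pos_INR (d - 2)).
  assert (Ht : 0 < kappa * Delta0) by nra.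
  assert (0 < 3 / kappa / (kappa * Delta0) ^ (d - 3))
    by (repeat apply Rdiv_lt_0_compat; try apply pow_lt; lra).
  assert (0 < 2 / (kappa * Delta0) ^ (d - 2))
    by (repeat apply Rdiv_lt_0_compat; try apply pow_lt; lra).
  nra.
Qed.

Lemma lip_grad_ball_upper (d : nat) (Delta eps Delta0 kappa rad : R) :
  (4 <= d)%nat -> 0 < Delta0 -> 0 < kappa -> Delta0 <= Delta ->
  kappa * Delta <= rad -> 2 < x1_opt Delta eps ->
  Rbar_le (lip_grad (f_fun d Delta eps) (closed_ball (0, 0) rad))
          (ball_lip_factor d Delta0 kappa * rad ^ (d - 2)).
Proof.
  intros Hd HD0 Hk HD Hrad HX.
  assert (Ht : 0 < kappa * Delta0) by nra.
  set (t := kappa * Delta0) in *.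
  assert (Htr : t <= rad) by (unfold t in *; nra).
  assert (Hr3 : t ^ (d - 3) <= rad ^ (d - 3)) by (apply pow_incr; lra).
  assert (Hr2 : t ^ (d - 2) <= rad ^ (d - 2)) by (apply pow_incr; lra).
  assert (Ht3 : 0 < t ^ (d - 3)) by (apply pow_lt; exact Ht).
  assert (Ht2 : 0 < t ^ (d - 2)) by (apply pow_lt; exact Ht).
  assert (B1 : 3 * Delta <= 3 / kappa / t ^ (d - 3) * rad ^ (d - 2)).
  { apply Rle_trans with (3 / kappa * rad).
    - replace (3 * Delta) with (3 / kappa * (kappa * Delta)) by (field; lra).
      apply Rmult_le_compat_l; [| exact Hrad].
      left; apply Rdiv_lt_0_compat; lra.
    - replace (d - 2)%nat with (S (d - 3)) by lia.
      replace (3 / kappa / t ^ (d - 3) * rad ^ S (d - 3))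
        with (3 / kappa * rad * (rad ^ (d - 3) / t ^ (d - 3)))
        by (simpl; field; lra).
      rewrite <- (Rmult_1_r (3 / kappa * rad)) at 1.
      apply Rmult_le_compat_l.
      + apply Rmult_le_pos; [left; apply Rdiv_lt_0_compat; lra | lra].
      + apply Rle_div_r; lra. }
  assert (B2 : 2 <= 2 / t ^ (d - 2) * rad ^ (d - 2)).
  { replace (2 / t ^ (d - 2) * rad ^ (d - 2))
      with (2 * rad ^ (d - 2) / t ^ (d - 2)) by (field; lra).
    apply Rle_div_r; lra. }
  assert (HB : lip_bound d Delta rad
               <= ball_lip_factor d Delta0 kappa * rad ^ (d - 2))
    by (unfold lip_bound, ball_lip_factor; fold t; lra).
  apply (proj1 (Glb_Rbar_correct _)); split.
  - apply Rle_trans with (2 := HB); unfold lip_bound.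
    assert (Hn := pos_INR (d - 2)).
    assert (0 <= (INR (d - 2) ^ 2 + 3 * INR (d - 2) + 2) * rad ^ (d - 2))
      by (apply Rmult_le_pos; nra).
    lra.
  - intros p q Hp Hq.
    assert (Hc : forall z : R * R, closed_ball (0, 0) rad z -> norm z <= rad).
    { intros [z1 z2] Hz; unfold closed_ball in Hz.
      replace (minus (z1, z2) (0, 0)) with (z1, z2) in Hz; [exact Hz |].
      change ((z1, z2) = (z1 + - 0, z2 + - 0)); f_equal; ring. }
    eapply Rle_trans.
    + apply grad_lipschitz_on_ball with (rad := rad); try assumption; [lra | |];
        apply Hc; assumption.
    + apply Rmult_le_compat_r; [apply norm_ge_0 | exact HB].
Qed.

(** * The theorem *)

Theorem mainTheorem6 :
  (* eps0, K: "eps small enough" and "Delta >> sqrt eps";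
     c2, C2: constants of Theta(Delta) *)
  exists eps0 K c2 C2 : R,
    0 < eps0 /\ 0 < K /\ 0 < c2 /\ 0 < C2 /\
    forall d : nat, Nat.Even d -> (4 <= d)%nat ->
    (* the constants of (iii) *)
    exists c3 C3 : R,
      0 < c3 /\ 0 < C3 /\
      (* Delta is a constant: it is only bounded below by some Delta0 > 0;
         kappa is the constant of R >= Omega(Delta) *)
      forall Delta0 kappa : R, 0 < Delta0 -> 0 < kappa ->
      exists C4 : R,
        0 < C4 /\
        forall eps Delta : R,
          0 < eps -> eps <= eps0 -> K * sqrt eps <= Delta ->
          let f := f_fun d Delta eps in
          let xopt : R * R := (Delta / eps ^ 200, 0) in
          let gap := f (0, 0) - f xopt in
          (* (i) *)
          (cont_differentiable f /\ coercive f /\ bounded_level_sets f) /\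
          (* (ii) *)
          (unique_minimizer f xopt /\ c2 * Delta <= gap <= C2 * Delta) /\
          (* (iii) *)
          ((forall p : R * R, eps_stationary f eps p ->
              c3 * (gap / (sqrt eps * ln (gap / sqrt eps) ^ 2)) <= norm p) /\
           eps_stationary f eps (Delta / sqrt eps, 0) /\
           (forall (x : nat -> R * R) (RT : R),
              x 0%nat = (0, 0) -> iterates_radius f eps x RT ->
              gap / sqrt eps <= C3 * ln (gap / sqrt eps) ^ 2 * RT)) /\
          (* (iv) *)
          (Rbar_le (Delta ^ (d - 2) * / eps ^ (200 * (d - 2)))
                   (lip_grad f (level_set f (0, 0))) /\
           (Delta0 <= Delta ->
            forall rad : R, kappa * Delta <= rad ->
              Rbar_le (lip_grad f (closed_ball (0, 0) rad))
                      (C4 * rad ^ (d - 2)))).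
Proof.
  exists (1 / 4), 100, (1 / 9), 1.
  do 4 (split; [lra |]).
  intros d Hev Hd.
  assert (Hn := pos_INR (d - 2)).
  assert (Hc3 : 0 < / (36 * (INR (d - 2) + 1))) by (apply Rinv_0_lt_compat; lra).
  exists (/ (36 * (INR (d - 2) + 1))), (36 * (INR (d - 2) + 1)).
  split; [exact Hc3 | split; [lra |]].
  intros Delta0 kappa HD0 Hk.
  exists (ball_lip_factor d Delta0 kappa).
  split; [apply ball_lip_factor_pos; assumption |].
  intros eps Delta He He4 HK f xopt gap.
  destruct (scales _ _ He He4 HK) as [Hs [Hu HX]].
  assert (HX2 : 2 < x1_opt Delta eps) by lra.
  assert (HD : 0 < Delta) by lra.
  assert (Hgap : 1 / 9 * Delta <= gap <= 1 * Delta)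
    by exact (gap_bounds d Delta eps HD HX2).
  assert (G1 : Delta / sqrt eps <= 9 * (gap / sqrt eps)).
  { replace (9 * (gap / sqrt eps)) with (9 * gap / sqrt eps) by (field; lra).
    apply Rmult_le_compat_r; [left; apply Rinv_0_lt_compat |]; lra. }
  assert (G2 : gap / sqrt eps <= Delta / sqrt eps).
  { apply Rmult_le_compat_r; [left; apply Rinv_0_lt_compat |]; lra. }
  assert (Hl := ln_10_lower (gap / sqrt eps) ltac:(lra)).
  assert (Hfar := fun p => stationary_far d Delta eps (gap / sqrt eps) p
                             Hev Hd He He4 HK G1 G2).
  fold f in Hfar.
  split; [| split; [| split]].
  - split; [apply f_cont_differentiable; (assumption || lra) |].
    apply f_coercive; assumption.
  - split; [exact (f_unique_minimizer d Delta eps Hev HD HX2) | exact Hgap].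
  - split; [| split].
    + intros p Hp; specialize (Hfar p Hp).
      replace (gap / (sqrt eps * ln (gap / sqrt eps) ^ 2))
        with (gap / sqrt eps / ln (gap / sqrt eps) ^ 2) by (field; lra).
      exact Hfar.
    + apply ridge_point_stationary; assumption.
    + intros x RT Hx0 [T [HT [_ Hball]]].
      specialize (Hfar (x T) HT).
      specialize (Hball T (Nat.le_refl T)); unfold closed_ball in Hball.
      rewrite Hx0 in Hball.
      assert (HN : norm (x T) <= RT).
      { destruct (x T) as [z1 z2].
        replace (minus (z1, z2) (0, 0)) with (z1, z2) in Hball; [exact Hball |].
        change ((z1, z2) = (z1 + - 0, z2 + - 0)); f_equal; ring. }
      set (l := ln (gap / sqrt eps)) in *.
      set (G := gap / sqrt eps) in *.
      set (n1 := INR (d - 2)) in *.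
      assert (Hl2 : 0 < l ^ 2) by nra.
      replace (/ (36 * (n1 + 1)) * (G / l ^ 2))
        with (G / (36 * (n1 + 1) * l ^ 2)) in Hfar by (field; lra).
      assert (Hden : 0 < 36 * (n1 + 1) * l ^ 2) by nra.
      apply Rle_div_l in Hfar; [| exact Hden].
      assert (norm (x T) * (36 * (n1 + 1) * l ^ 2) <= RT * (36 * (n1 + 1) * l ^ 2))
        by (apply Rmult_le_compat_r; lra).
      lra.
  - split.
    + replace (Delta ^ (d - 2) * / eps ^ (200 * (d - 2)))
        with (x1_opt Delta eps ^ (d - 2)).
      * apply lip_grad_level_set_lower; assumption.
      * unfold x1_opt; rewrite pow_mult; unfold Rdiv.
        rewrite Rpow_mult_distr, pow_inv; reflexivity.
    + intros HDD rad Hrad.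
      apply lip_grad_ball_upper; assumption.
Qed.
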